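(* Let $n\ge 1$, $p\in(1,2)$ and $k_3>0$. Define $\phi_1,\phi_2:\mathbb{R}^n\to\mathbb{R}^n$ by $$\phi_1(e_1)=k_3e_1+(e_1^{T}e_1)^{\frac{1-p}{3p-2}}e_1,$$ $$\phi_2(e_1)=k_3^2e_1+\frac{2k_3(2p-1)}{3p-2}(e_1^{T}e_1)^{\frac{1-p}{3p-2}}e_1+\frac{p}{3p-2}(e_1^{T}e_1)^{\frac{2(1-p)}{3p-2}}e_1 .$$ Let $k_1,k_2>0$ be gains such that the matrix $$\mathcal{A}^*=\begin{bmatrix}-k_1&1\\-k_2&0\end{bmatrix}\in\mathbb{R}^{2\times2}$$ is Hurwitz. Then for the system $$\dot e_1=-k_1\phi_1(e_1)+e_2,\qquad \dot e_2=-k_2\phi_2(e_1),\qquad (e_1,e_2)\in\mathbb{R}^n\times\mathbb{R}^n,$$ the state $(e_1,e_2)\in\mathbb{R}^{2n}$ converges to the origin in a fast finite-time stable manner, i.e. the system is fast finite-time stable at the origin.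
   Context: At $e_1=0$ the functions $\phi_1,\phi_2$ are defined by continuous extension, $\phi_1(0)=\phi_2(0)=0$ (the terms involving powers of $e_1^Te_1$ tend to $0$ as $e_1\to0$ since $1<p<2$). Fast finite-time stability: a system $\dot x=f(x)$ on $\mathbb{R}^N$ with equilibrium $x=0$ is called fast finite-time stable (FFTS) at the origin if the origin is Lyapunov stable and there exist a continuous positive definite function $V$ on $\mathbb{R}^N$ and constants $\lambda_1,\lambda_2>0$, $\alpha\in(0,1)$ such that every solution with initial value $x_0$ reaches the origin, and remains there, within a settling time $T$ satisfying $$T\le\frac{1}{\lambda_1(1-\alpha)}\ln\frac{\lambda_1V^{1-\alpha}(x_0)+\lambda_2}{\lambda_2}.$$ (This is the property implied by the Lyapunov inequality $\dot V\le-\lambda_1V-\lambda_2V^{\alpha}$.) *)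

(* Defs.v *)
From HB Require Import structures.
From mathcomp Require Import all_boot all_order all_algebra.
From mathcomp Require Import complex.
From mathcomp Require Import all_classical all_reals all_analysis.

Set Implicit Arguments.
Unset Strict Implicit.
Unset Printing Implicit Defensive.

Import Order.TTheory GRing.Theory Num.Theory.
Import numFieldNormedType.Exports.

Local Open Scope classical_set_scope.
Local Open Scope ring_scope.

Section Stability.
Context {R : realType} {E : normedModType R}.
Implicit Types (f : E -> E) (x y : R -> E) (b : \bar R).

Definition time_domain b : set R := [set t | 0 <= t /\ (t%:E < b)%E].

(* A forward solution of x' = f(x) on [0, b[, with b possibly +oo. The values
   of [x] outside [0, b[ are irrelevant. When f is continuous, continuity at 0
   and the equation on ]0, b[ yield the right derivative f (x 0) at 0. *)
Definition solution_on f b x : Prop :=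
  [/\ (0 < b)%E,
      {within time_domain b, continuous x} &
      forall t, 0 < t -> (t%:E < b)%E -> is_derive t 1 x (f (x t))].

Definition maximal_solution_on f b x : Prop :=
  solution_on f b x /\
  forall b' y, (b <= b')%E -> solution_on f b' y ->
    (forall t, time_domain b t -> y t = x t) -> b' = b.

Definition lyapunov_stable f : Prop :=
  forall eps : R, 0 < eps -> exists2 delta : R, 0 < delta &
    forall b x, solution_on f b x -> `|x 0| < delta ->
      forall t, time_domain b t -> `|x t| < eps.

Definition positive_definite (V : E -> R) : Prop :=
  V 0 = 0 /\ forall z, z != 0 -> 0 < V z.

(* Neither uniqueness nor global existence of solutions is assumed, hence the
   quantification over all maximal solutions. *)
Definition fast_finite_time_stable f : Prop :=
  [/\ f 0 = 0,
      lyapunov_stable f &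
      exists (V : E -> R) (lambda1 lambda2 alpha : R),
        [/\ continuous V /\ positive_definite V,
            0 < lambda1, 0 < lambda2, 0 < alpha < 1 &
            forall b x, maximal_solution_on f b x ->
              exists T : R,
                [/\ time_domain b T,
                    T <= (lambda1 * (1 - alpha))^-1 *
                         ln ((lambda1 * V (x 0) `^ (1 - alpha) + lambda2)
                             / lambda2) &
                    forall t, time_domain b t -> T <= t -> x t = 0]]].

End Stability.

Definition hurwitz (R : realType) (m : nat) (A : 'M[R]_m) : Prop :=
  forall l : R[i],
    eigenvalue (map_mx (real_complex R) A) l -> complex.Re l < 0.

Section System.
Context {R : realType} {n : nat}.
Implicit Types (e : 'cV[R]_n) (p : R).

Definition sqnorm e : R := (e^T *m e) 0 0.

(* For 1 < p < 2 the exponents are negative and [0 `^ a = 0] for [a != 0]; at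
   e = 0 the power is moreover multiplied by e, so phi1 and phi2 vanish there,
   which is their continuous extension. *)
Definition phi1 (k3 : R) p e : 'cV[R]_n :=
  k3 *: e + sqnorm e `^ ((1 - p) / (3 * p - 2)) *: e.

Definition phi2 (k3 : R) p e : 'cV[R]_n :=
  k3 ^+ 2 *: e
  + (2 * k3 * (2 * p - 1) / (3 * p - 2)
     * sqnorm e `^ ((1 - p) / (3 * p - 2))) *: e
  + (p / (3 * p - 2) * sqnorm e `^ (2 * (1 - p) / (3 * p - 2))) *: e.

Definition error_system (k1 k2 k3 : R) p (z : 'cV[R]_n * 'cV[R]_n) :
    'cV[R]_n * 'cV[R]_n :=
  (- k1 *: phi1 k3 p z.1 + z.2, - k2 *: phi2 k3 p z.1).

End System.

Definition gain_matrix (R : realType) (k1 k2 : R) : 'M[R]_2 :=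
  block_mx (- k1)%:M 1%:M (- k2)%:M 0 : 'M[R]_(1 + 1).

(* Main.v *)
Require Import Defs.
From mathcomp Require Import all_boot all_order all_algebra.
From mathcomp Require Import all_classical all_reals all_analysis.
From mathcomp Require Import ring lra.
Import Order.TTheory GRing.Theory Num.Theory.
Import numFieldNormedType.Exports.
Local Open Scope classical_set_scope.
Local Open Scope ring_scope.

Set Implicit Arguments.
Unset Strict Implicit.
Unset Printing Implicit Defensive.

(* Put q = (p - 1) / (3 p - 2), w = |e1|^(-2 q) and J = phi1'(e1). Then
   phi1 = (k3 + w) e1 and phi2 = J phi1, so that zeta = (phi1(e1), e2) satisfies
   zeta' = (I (x) J) (A (x) I) zeta with A the gain matrix. For V = zeta^T P zeta
   with A^T P + P A = -2 I this gives V' <= -2 (k3 + (1 - 2 q) w) |zeta|^2, and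
   w >= |zeta|^(-2 q / (1 - 2 q)) turns it into V' <= - lam1 V - lam2 V^alpha
   with 1 - alpha = q / (1 - 2 q).
   V is not differentiable along solutions when e1 = 0, but if e2 <> 0 then
   e1' = e2 <> 0, so such instants are isolated and continuity of V suffices.
   Since the field is not Lipschitz at e1 = 0, the fact that bounded maximal
   solutions are global rests on Peano's theorem; it is obtained as a pointwise
   ultrafilter limit of Euler schemes, which avoids integrals and equicontinuity. *)

(** * Comparison principle for continuous real functions *)

(* Compare [W] with the last point at which it takes a value strictly between
   [W a] and [W b]. *)
Lemma le_of_right_locally_le (R : realType) (W : R -> R) (a b : R) :
  a <= b -> {within `[a, b], continuous W} ->
  (forall t, a < t < b -> W a < W t -> \forall s \near t^'+, W s <= W t) ->
  W b <= W a.
Proof.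
move=> ab cW loc; rewrite leNgt; apply/negP => Wab.
(* The level [y] is strictly between the end values, so the supremum [c] of [S] will be interior
   with [W a < W c], as the local hypothesis requires. *)
pose y := (W a + W b) / 2.
have Way : W a < y by rewrite /y; lra.
have yWb : y < W b by rewrite /y; lra.
pose S := [set t | a <= t <= b /\ W t <= y].
have Sa : S a by split; [rewrite lexx|exact: ltW].
have Sub : ubound S b by move=> t [/andP[]].
have hS : has_sup S by split; [exists a|exists b].
set c := sup S.
have ac : a <= c by exact: sup_upper_bound.
have cb : c <= b by exact: ge_sup (ex_intro _ _ Sa) Sub.
have cc : W s @[s --> within `[a, b] (nbhs c)] --> W c.
  by move/subspace_continuousP : cW; apply; rewrite /= in_itv/= ac cb.
have Wc : W c <= y.
  rewrite leNgt; apply/negP => yWc.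
  have := cc _ (@lt_nbhsr _ y (W c) yWc) => /=.
  rewrite /nbhs /= => -[e /= e0 He].
  have [s [/andP[as_ sb] Ws] cs] := sup_adherent e0 hS.
  have sc : s <= c by apply: sup_upper_bound => //; split=> //; rewrite as_.
  have := He s; rewrite /ball_ /= in_itv /= as_ sb ger0_norm ?subr_ge0 //.
  rewrite ltrBlDr -ltrBlDl => /(_ cs isT).
  by rewrite ltNge Ws.
have {}cb : c < b by rewrite lt_neqAle cb andbT; apply/eqP => E; move: Wc; rewrite E leNgt yWb.
have above s : c < s -> s <= b -> y < W s.
  move=> cs sb; rewrite ltNge; apply/negP => Ws.
  have : s <= c by apply: sup_upper_bound => //; split=> //; rewrite sb (le_trans ac (ltW cs)).
  by rewrite leNgt cs.
have Wc' : y <= W c.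
  rewrite leNgt; apply/negP => Wcy.
  have /(_ (within_filter _ _)) := cvgr_lt _ cc _ Wcy.
  rewrite near_withinE /nbhs /= => -[e /= e0 He].
  pose s := Num.min b (c + e / 2).
  have cs : c < s by rewrite /s lt_min cb ltrDl divr_gt0.
  have sb : s <= b by rewrite /s ge_min lexx.
  have sce : s <= c + e / 2 by rewrite /s ge_min lexx orbT.
  have := He s; rewrite /ball_ /= in_itv /= sb (le_trans ac (ltW cs)) distrC gtr0_norm ?subr_gt0 //.
  have se : s - c < e by lra.
  by move=> /(_ se isT); rewrite ltNge ltW // above.
have {}Wc : W c = y by apply/eqP; rewrite eq_le Wc.
have {}ac : a < c by rewrite lt_neqAle ac andbT; apply/eqP => E; move: Way; rewrite E Wc ltxx.
(* The local hypothesis keeps [W] at most [y] just after [c], against [above]. *)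
have := loc c; rewrite ac cb Wc => /(_ isT Way).
rewrite /at_right near_withinE /nbhs /= => -[e /= e0 He].
pose s := Num.min b (c + e / 2).
have cs : c < s by rewrite /s lt_min cb ltrDl divr_gt0.
have sb : s <= b by rewrite /s ge_min lexx.
have sce : s <= c + e / 2 by rewrite /s ge_min lexx orbT.
have := He s; rewrite /ball_ /= distrC gtr0_norm ?subr_gt0 //.
have se : s - c < e by lra.
by move=> /(_ se cs); rewrite leNgt above.
Qed.

(** * Derivatives in normed spaces and a mean value inequality *)

Section NormedODE.
Context {R : realType} {E : normedModType R}.
Implicit Types (x : R -> E) (l : E) (A : set R).

(** A derivative stated as a first-order error bound relative to [A]. This avoids quotients and
    covers one-sided derivatives at the ends of an interval. *)
Definition has_slope A x l (t : R) := forall eps : R, 0 < eps ->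
  exists2 eta : R, 0 < eta &
    forall s, A s -> `|s - t| < eta ->
      `|x s - x t - (s - t) *: l| <= eps * `|s - t|.

Lemma is_derive_has_slope x l (t : R) :
  is_derive t 1 x l <-> has_slope setT x l t.
Proof.
split.
  move=> [dx <-] eps eps0.
  move/cvgrPdist_le : dx => /(_ _ eps0).
  rewrite /dnbhs near_withinE /nbhs /= => -[e /= e0 He].
  exists e => // s _ st.
  have [->|nst] := eqVneq s t; first by rewrite !subrr scale0r subr0 !normr0 mulr0.
  have st0 : s - t != 0 by rewrite subr_eq0.
  have := He (s - t); rewrite /ball_ /= sub0r normrN => /(_ st st0).
  rewrite [_%:A]mulr1 subrK distrC => H.
  rewrite mulrC -ler_pdivrMl ?normr_gt0 // -normfV -normrZ scalerBr scalerA mulVf // scale1r.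
  by apply: le_trans H; rewrite le_eqVlt; apply/orP; left; apply/eqP.
move=> H.
have dl : (h^-1 *: ((x \o shift t) (h *: 1) - x t)) @[h --> 0^'] --> l.
  apply/cvgrPdist_le => eps eps0.
  rewrite /dnbhs near_withinE /nbhs /=.
  have [e e0 He] := H _ eps0.
  exists e => // h; rewrite /ball_ /= sub0r normrN => he h0.
  have := He (h + t) I; rewrite addrK => /(_ he).
  rewrite [_%:A]mulr1 distrC => K.
  rewrite -(@ler_pM2l _ `|h|) ?normr_gt0 // -normrZ scalerBr scalerA mulfV // scale1r.
  by rewrite mulrC [leRHS]mulrC mulrC.
split; first by apply/cvg_ex; exists l.
exact/cvg_lim.
Qed.

(** The comparison principle applies to the deviation from the line of slope [l], minus a linear
    function of slope slightly above [eps]. With [l = 0] this is a Lipschitz bound. *)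
Lemma mean_value_ineq x l (a b eps : R) : a <= b ->
  {within `[a, b], continuous x} ->
  (forall t, a < t < b -> exists2 l', is_derive t 1 x l' & `|l' - l| <= eps) ->
  `|x b - x a - (b - a) *: l| <= eps * (b - a).
Proof.
move=> ab cx dx; apply/ler_addgt0Pr => e e0.
have [->|nab] := eqVneq b a.
  by rewrite !subrr scale0r subr0 normr0 mulr0 add0r ltW.
have ba0 : 0 < b - a by rewrite subr_gt0 lt_neqAle eq_sym nab.
(* The slack [e'] absorbs the remainder of the first-order expansion at [t] and costs [e] in total
   over [[a, b]]. *)
set e' := e / (b - a).
have e'0 : 0 < e' by rewrite divr_gt0.
pose W t := `|x t - x a - (t - a) *: l| - (eps + e') * (t - a).
suff : W b <= W a.
  rewrite /W !subrr scale0r subr0 normr0 mulr0 subr0 subr_le0 => H.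
  by apply: le_trans H _; rewrite mulrDl divfK ?gt_eqF.
apply: le_of_right_locally_le => //.
  apply/subspace_continuousP => t tab.
  have ct := (@subspace_continuousP _ _ _ x).1 cx t tab.
  have cid : s @[s --> within `[a, b] (nbhs t)] --> t by apply: cvg_within.
  have csub : s - a @[s --> within `[a, b] (nbhs t)] --> t - a.
    by apply: cvgB => //; exact: cvg_cst.
  apply: cvgB; last by apply: cvgM => //; exact: cvg_cst.
  apply: cvg_norm; apply: cvgB; last by apply: cvgZr_tmp.
  by apply: cvgB => //; exact: cvg_cst.
move=> t tab _.
have [l' /is_derive_has_slope /(_ _ e'0)[eta eta0 Heta] ll'] := dx t tab.
rewrite /at_right near_withinE /nbhs /=; exists eta => // s; rewrite /ball_ /= => ts st.
rewrite distrC in ts; have := Heta s I ts; rewrite gtr0_norm ?subr_gt0 // => H.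
rewrite /W lerBlDr.
have -> : x s - x a - (s - a) *: l =
  (x t - x a - (t - a) *: l) + ((x s - x t - (s - t) *: l') + (s - t) *: (l' - l)).
  have -> : s - a = (s - t) + (t - a) by ring.
  rewrite scalerDl scalerBr; move: ((s - t) *: l) ((t - a) *: l) ((s - t) *: l') => u v w.
  rewrite (addrA _ w (- u)) subrK [RHS]addrC !addrA.
  rewrite (addrAC _ (- u) (x t)) subrK opprD !addrA.
  by rewrite (addrAC (x s) (- u)).
apply: le_trans (ler_normD _ _) _.
have := ler_normD (x s - x t - (s - t) *: l') ((s - t) *: (l' - l)).
rewrite normrZ gtr0_norm ?subr_gt0 //.
have : (s - t) * `|l' - l| <= (s - t) * eps by rewrite ler_wpM2l // subr_ge0 ltW.
move: H; move: (`|_ + _|) `|x t - _ - _| `|_ - _| `|_ - _| => n1 n2 n3 n4.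
by lra.
Qed.

End NormedODE.

(** * Peano's existence theorem *)

Lemma compact_ultra_cvg (I : Type) (T : topologicalType) (U : set_system I)
    (u : I -> T) (K : set T) :
  UltraFilter U -> compact K -> U (u @^-1` K) -> exists2 p, K p & u i @[i --> U] --> p.
Proof.
move=> UU cK UK; have [p [Kp clp]] := cK (u @ U) _ UK.
(* A cluster point of an ultrafilter is a limit: if the preimage of [A] were not in [U], its
   complement would be, and [p] could not be a cluster point. *)
exists p => // A /= pA; have [//|UnA] := in_ultra_setVsetC (u @^-1` A) UU.
by have [z [nAz Az]] := clp _ _ (UnA : (u @ U) (~` A)) pA.
Qed.

Section Peano.
Context {R : realType} {E : normedModType R}.
Implicit Types (x : R -> E) (f : E -> E) (z : nat -> E).

(** A discrete mean value inequality: each Euler step adds an error of at most [eps * d]. It serves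
    with [c = 0] for Lipschitz bounds and with [c = f (x s)] for slopes. *)
Lemma euler_sum f z (d eps : R) (c : E) (i j : nat) : 0 <= d -> (i <= j)%N ->
  (forall k, z k.+1 = z k + d *: f (z k)) ->
  (forall k, (i <= k < j)%N -> `|f (z k) - c| <= eps) ->
  `|z j - z i - ((j%:R - i%:R) * d) *: c| <= eps * ((j%:R - i%:R) * d).
Proof.
move=> d0 + zS; elim: j => [|j IHj].
  by rewrite leqn0 => /eqP ->; rewrite !subrr mul0r scale0r mulr0 subr0 normr0.
rewrite leq_eqVlt => /predU1P[->|ij] H.
  by rewrite !subrr mul0r scale0r mulr0 subr0 normr0.
have {}IHj := IHj ij (fun k => _).
have {IHj} : `|z j - z i - ((j%:R - i%:R) * d) *: c| <= eps * ((j%:R - i%:R) * d).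
  by apply: IHj => k /andP[ik kj]; apply: H; rewrite ik ltnW.
have {H} : `|f (z j) - c| <= eps by apply: H; rewrite ltnSn andbT.
move=> /(ler_wpM2l d0); rewrite -[X in X * `|_|]ger0_norm // -normrZ => H1 H2.
have -> : z j.+1 - z i - ((j.+1%:R - i%:R) * d) *: c =
    (z j - z i - ((j%:R - i%:R) * d) *: c) + d *: (f (z j) - c).
  rewrite zS -natr1.
  have -> : (j%:R + 1 - i%:R) * d = (j%:R - i%:R) * d + d by ring.
  rewrite scalerDl scalerBr; move: (_ *: c) (d *: c) (d *: _) => u v w.
  by rewrite opprD !addrA (addrAC _ w (- z i)) (addrAC _ w (- u)).
apply: le_trans (ler_normD _ _) _; apply: le_trans (lerD H2 H1) _.
by rewrite -natr1; lra.
Qed.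

(** Compactness of closed balls stands for finite dimension. At the times 0 and [h] the slope
    obtained is one-sided. *)
Lemma peano f (x0 : E) : (forall r : R, compact [set z : E | `|z| <= r]) ->
  continuous f ->
  exists (h : R) (x : R -> E), [/\ 0 < h, x 0 = x0 &
    forall t, 0 <= t <= h -> has_slope [set s | 0 <= s <= h] x (f (x t)) t].
Proof.
move=> cE cf.
pose K := [set z : E | `|z| <= `|x0| + 1].
have cK : compact K := cE _.
have [M M1 fM] : exists2 M : R, 1 <= M & forall w, K w -> `|f w| <= M.
  have : compact (f @` K).
    by apply: continuous_compact => //; exact: continuous_subspaceT.
  move=> /compact_bounded[M [_ HM]]; exists (Num.max 1 (M + 1)).
    by rewrite le_max lexx.
  by move=> w Kw; rewrite le_max (HM (M + 1)) ?orbT ?ltrDl //; exists w.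
have M0 : 0 < M by lra.
(* At speed at most [M], the Euler iterates up to time [1 / M] move by at most 1 and stay in [K]. *)
pose h := M^-1; have h0 : 0 < h by rewrite invr_gt0.
have nearK (w : E) : `|w - x0| <= 1 -> K w.
  move=> H; rewrite /K /=; apply: le_trans (_ : _ <= `|(w - x0) + x0|) _.
    by rewrite subrK.
  by apply: le_trans (ler_normD _ _) _; rewrite addrC lerD2l.
pose d (k : nat) : R := k.+1%:R^-1.
have d0 k : 0 < d k by rewrite invr_gt0 ltr0n.
pose z k j := iter j (fun w => w + d k *: f w) x0.
have zS k j : z k j.+1 = z k j + d k *: f (z k j) by [].
have zK k j : j%:R * d k <= h -> K (z k j).
  elim/ltn_ind: j => j IHj jh; apply: nearK.
  have := @euler_sum f (z k) (d k) M 0 0 j (ltW (d0 k)) (leq0n _) (zS k).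
  rewrite scaler0 !subr0; move=> H; apply: le_trans (H _) _.
    move=> i /= ij; rewrite subr0; apply: fM; apply: IHj => //.
    by apply: le_trans jh; rewrite ler_pM2r // ler_nat ltnW.
  apply: le_trans (_ : _ <= M * h) _; first by rewrite ler_pM2l.
  by rewrite mulfV // gt_eqF.
have zlip k i j : (i <= j)%N -> j%:R * d k <= h ->
    `|z k j - z k i| <= M * ((j%:R - i%:R) * d k).
  move=> ij jh.
  have := @euler_sum f (z k) (d k) M 0 i j (ltW (d0 k)) ij (zS k).
  rewrite scaler0 !subr0; apply=> l /andP[il lj]; rewrite subr0.
  apply: fM; apply: zK; apply: le_trans jh.
  by rewrite ler_pM2r // ler_nat ltnW.
(* [N k t] counts the Euler steps of length [d k] completed by time [t]. *)
pose N k (t : R) := Num.truncn (t * k.+1%:R).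
have Nd k (t : R) : 0 <= t -> (N k t)%:R * d k <= t < (N k t)%:R * d k + d k.
  move=> t0; have /truncn_itv : 0 <= t * k.+1%:R by rewrite mulr_ge0.
  rewrite -/(N k t) -[(N k t).+1%:R]natr1 => /andP[N1 N2].
  have -> : (N k t)%:R * d k + d k = ((N k t)%:R + 1) / k.+1%:R by rewrite mulrDl mul1r.
  by rewrite /d ler_pdivrMr ?ltr0n // ltr_pdivlMr ?ltr0n // N1.
(* A single ultrafilter serves all times, so estimates relating different times survive the
   limit. *)
have [U [UU Uoo]] := @ultraFilterLemma nat \oo _.
have /choice[x Hx] : forall t : R, exists y : E, 0 <= t <= h -> z k (N k t) @[k --> U] --> y.
  move=> t; have [th|] := boolP (0 <= t <= h); last by exists 0.
  have [//|p _ Hp] := @compact_ultra_cvg _ _ U (fun k => z k (N k t)) K _ cK.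
    near=> k; apply: zK; case/andP: th => t0; apply: le_trans.
    by case/andP: (Nd k t t0).
  by exists p.
exists h, x; split => //.
  have := Hx 0; rewrite lexx ltW // => /(_ isT).
  have -> : (fun k => z k (N k 0)) = cst x0.
    by apply/funext => k; rewrite /N mul0r truncn0.
  by move=> /(cvg_unique _) /(_ (cvg_cst _)) ->.
move=> s sh.
(* Increments over an interval [[a, b]] near [s] include both [s = a] and [s = b], hence both sides
   of [s]. *)
suff strict (eps : R) : 0 < eps -> exists2 eta, 0 < eta & forall a b,
    0 <= a <= h -> 0 <= b <= h -> a <= b -> `|a - s| < eta -> `|b - s| < eta ->
    `|x b - x a - (b - a) *: f (x s)| <= eps * (b - a).
  move=> eps /strict[eta eta0 Heta]; exists eta => // t th ts.
  have ss : `|s - s| < eta by rewrite subrr normr0.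
  have [st|ts'] := leP s t.
    by rewrite [`|t - s|]ger0_norm ?subr_ge0 //; exact: Heta.
  rewrite [`|t - s|]ltr0_norm ?subr_lt0 // opprB.
  have -> : x t - x s - (t - s) *: f (x s) = - (x s - x t - (s - t) *: f (x s)).
    by rewrite -(opprB s t) scaleNr -(opprB (x s) (x t)) -opprD.
  by rewrite normrN; apply: Heta => //; exact: ltW.
move=> eps0.
have := cf (x s) => /cvgrPdist_le /(_ _ eps0); rewrite /nbhs /=.
move=> /nbhs_ballP[r /= r0 Hr].
have {}Hr w : `|w - x s| < r -> `|f w - f (x s)| <= eps.
  by move=> wr; rewrite distrC; apply: Hr; rewrite -ball_normE /ball_ /= distrC.
(* The iterates between times [a] and [b] will lie within [M * (r / (4 * M) + d k) < r / 2] of the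
   iterate at [s], which is within [r / 4] of [x s]. So [f] varies by at most [eps] on them. *)
exists (r / (4 * M)); first by rewrite divr_gt0 // mulr_gt0.
move=> a b ah bh ab as_ bs_.
apply/ler_addgt0Pr => e e0.
(* The three terms pay for the time rounding multiplied by the norm of [f (x s)], the same rounding
   multiplied by [eps], and the two endpoint approximations. *)
pose e1 := e / (`|f (x s)| + eps + 2).
have C0 : 0 < `|f (x s)| + eps + 2 by rewrite ltr_wpDl // addr_ge0 // ltW.
have e10 : 0 < e1 by rewrite divr_gt0.
have r4 : 0 < r / 4 by rewrite divr_gt0.
have rM : 0 < r / (4 * M) by rewrite divr_gt0 // mulr_gt0.
have small q : 0 < q -> U [set k | d k < q].
  by move=> q0; apply: Uoo; exact: (near_infty_natSinv_lt (PosNum q0)).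
have [k [[[za zb] zs] [kd1 kd2]]] : exists k, [/\ `|z k (N k a) - x a| <= e1,
    `|z k (N k b) - x b| <= e1 & `|z k (N k s) - x s| <= r / 4] /\
    (d k < e1 /\ d k < r / (4 * M)).
  have PF : ProperFilter U by exact: ultra_proper.
  apply: (@filter_ex _ U); apply: filterI; last by apply: filterI; exact: small.
  have /cvgr_distC_le /(_ _ e10) Ha := Hx _ ah.
  have /cvgr_distC_le /(_ _ e10) Hb := Hx _ bh.
  have /cvgr_distC_le /(_ _ r4) Hs := Hx _ sh.
  by near=> k; split; near: k.
have /andP[a0 ah'] := ah; have /andP[b0 bh'] := bh; have /andP[s0 sh'] := sh.
have /andP[a1 a2] := Nd k a a0.
have /andP[b1 b2] := Nd k b b0.
have /andP[s1 s2] := Nd k s s0.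
have Nle : (N k a <= N k b)%N by apply: le_truncn; rewrite ler_pM2r // ltr0n.
have Me : M * (r / (4 * M)) = r / 4 by field; rewrite gt_eqF.
have fNab l : (N k a <= l < N k b)%N -> `|f (z k l) - f (x s)| <= eps.
  move=> /andP[al lb].
  apply: Hr.
  have al' : (N k a)%:R * d k <= l%:R * d k by rewrite ler_pM2r // ler_nat.
  have lb' : l%:R * d k <= (N k b)%:R * d k by rewrite ler_pM2r // ler_nat ltnW.
  have zz : `|z k l - z k (N k s)| <= M * (r / (4 * M) + d k).
    have [ls|sl] := leqP l (N k s).
      rewrite distrC; apply: le_trans (zlip _ _ _ ls _) _; first exact: le_trans s1 _.
      rewrite ler_pM2l // mulrBl; move: as_; rewrite ltr_norml; lra.
    apply: le_trans (zlip _ _ _ (ltnW sl) _) _; first by apply: le_trans lb' _; exact: le_trans b1 _.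
    rewrite ler_pM2l // mulrBl; move: bs_; rewrite ltr_norml; lra.
  have Md : M * d k < M * (r / (4 * M)) by rewrite ltr_pM2l.
  have := ler_normD (z k l - z k (N k s)) (z k (N k s) - x s).
  rewrite addrA subrK; move: zz Md; rewrite mulrDr Me; lra.
have := euler_sum (ltW (d0 k)) Nle (zS k) fNab; set D := (_ - _) * d k => HD.
have -> : x b - x a - (b - a) *: f (x s) =
    (z k (N k b) - z k (N k a) - D *: f (x s)) +
    ((z k (N k a) - x a) - (z k (N k b) - x b)) + (D - (b - a)) *: f (x s).
  rewrite (scalerBl D).
  move: (z k (N k b)) (z k (N k a)) (D *: _) ((b - a) *: _) => v u Dc bc.
  rewrite (opprB v) [x b - v]addrC (addrACA u) -(opprB v u).
  by rewrite (addrACA (v - u)) subrr add0r (addrC (- Dc)) addrA subrK (addrC (- x a)).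
apply: le_trans (ler_normD _ _) _; apply: le_trans (lerD (ler_normD _ _) (lexx _)) _.
rewrite normrZ.
have DD : `|D - (b - a)| <= e1 by rewrite /D ler_norml mulrBl; apply/andP; split; lra.
have DC : `|D - (b - a)| * `|f (x s)| <= e1 * `|f (x s)| by rewrite ler_wpM2r.
have eD : eps * D <= eps * (b - a) + eps * e1.
  by rewrite -mulrDr ler_pM2l //; move: DD; rewrite ler_norml; lra.
have eE : e = e1 * `|f (x s)| + e1 * eps + e1 * 2 by rewrite -!mulrDr /e1 divfK // gt_eqF.
have := ler_normB (z k (N k a) - x a) (z k (N k b) - x b).
by move: za zb HD DC eD eE; lra.
Unshelve. all: by end_near.
Qed.
End Peano.

(** * Prolongation of bounded solutions *)

Section Prolongation.
Context {R : realType} {E : normedModType R}.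
Implicit Types (x y : R -> E) (f : E -> E).

Lemma has_slope_opp x (l : E) (s t eps : R) :
  `|x t - x s - (t - s) *: l| <= eps -> `|x s - x t - (s - t) *: l| <= eps.
Proof.
have -> : x s - x t - (s - t) *: l = - (x t - x s - (t - s) *: l).
  by rewrite -(opprB t s) scaleNr -(opprB (x t) (x s)) -opprD.
by rewrite normrN.
Qed.

Lemma is_derive_continuous x (l : E) (t : R) : is_derive t 1 x l ->
  x s @[s --> t] --> x t.
Proof. by move=> [/derivable1_diffP /differentiable_continuous]. Qed.

(** A bounded solution has bounded speed, so it is Lipschitz and has a limit [z] at [b]. Peano's
    theorem restarts it from [z]. The glued curve has a left derivative at [b] because [f (x t)]
    tends to [f z]. *)
Lemma solution_prolongation f (b M : R) x :
  (forall r : R, compact [set z : E | `|z| <= r]) -> continuous f ->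
  solution_on f b%:E x -> (forall t, 0 <= t < b -> `|x t| <= M) ->
  exists (b' : R) y, [/\ b < b', solution_on f b'%:E y &
    forall t, 0 <= t < b -> y t = x t].
Proof.
move=> cE cf [b0 cx dx] xM; rewrite lte_fin in b0.
have {}dx t : 0 < t < b -> is_derive t 1 x (f (x t)).
  by case/andP=> t0 tb; apply: dx.
have {}cx s t : 0 <= s -> t < b -> {within `[s, t], continuous x}.
  move=> s0 tb; apply: continuous_subspaceW cx => r /=.
  rewrite in_itv/= /time_domain /= lte_fin => /andP[sr rt].
  by rewrite (le_trans s0 sr) (le_lt_trans rt tb).
pose K := [set z : E | `|z| <= M].
have cK : compact K := cE _.
have [C C0 fC] : exists2 C : R, 0 < C & forall w, K w -> `|f w| <= C.
  have : compact (f @` K).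
    by apply: continuous_compact => //; exact: continuous_subspaceT.
  move=> /compact_bounded[C [_ HC]]; exists (Num.max 1 (C + 1)).
    by rewrite lt_max ltr01.
  by move=> w Kw; rewrite le_max (HC (C + 1)) ?orbT ?ltrDl //; exists w.
have lip s t : 0 <= s -> s <= t -> t < b -> `|x t - x s| <= C * (t - s).
  move=> s0 st tb.
  have := @mean_value_ineq _ _ x 0 s t C st (cx s t s0 tb).
  rewrite scaler0 subr0; apply=> r /andP[sr rt]; exists (f (x r)).
    by apply: dx; rewrite (le_lt_trans s0 sr) (lt_trans rt tb).
  by rewrite subr0; apply: fC; apply: xM; rewrite (le_trans s0 (ltW sr)) (lt_trans rt tb).
have [z [_ clz]] : K `&` cluster (x t @[t --> b^'-]) !=set0.
  apply: cK; rewrite /nbhs /=; near=> t; apply: xM.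
  by apply/andP; split; near: t; [apply: nbhs_left_ge|apply: nbhs_left_lt].
(* Letting [t] approach [b] with [x t] near the cluster point extends the Lipschitz bound to [z],
   which is therefore the left limit of [x]. *)
have {clz} zx s : 0 <= s -> s < b -> `|z - x s| <= C * (b - s).
  move=> s0 sb; apply/ler_addgt0Pr => e e0.
  have A : (x t @[t --> b^'-]) (x @` `]s, b[).
    rewrite /nbhs /=; near=> t; exists t => //=; rewrite in_itv/=.
    by apply/andP; split; near: t; [apply: nbhs_left_gt|apply: nbhs_left_lt].
  have [_ [[t + <-] zt]] := clz _ _ A (nbhsx_ballx z e e0).
  rewrite /= in_itv /= => /andP[st tb].
  move: zt; rewrite -ball_normE /ball_ /= => zt.
  have := ler_normD (z - x t) (x t - x s); rewrite addrA subrK.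
  have := lip s t s0 (ltW st) tb.
  have : C * (t - s) <= C * (b - s) by rewrite ler_pM2l //; lra.
  lra.
have [h [y [h0 y0 dy]]] := peano z cE cf.
pose w t := if t < b then x t else y (t - b).
have wx t : t < b -> w t = x t by rewrite /w => ->.
have wb : w b = z by rewrite /w ltxx subrr.
have wy t : b <= t -> w t = y (t - b) by rewrite /w ltNge => ->.
have dwx t : 0 < t < b -> is_derive t 1 w (f (w t)).
  move=> /[dup] tb /andP[t0 tb']; rewrite wx //.
  apply/is_derive_has_slope => eps /((is_derive_has_slope _ _ _).1 (dx t tb))[eta eta0 Heta].
  exists (Num.min eta (b - t)); first by rewrite lt_min eta0 subr_gt0.
  move=> s _; rewrite lt_min => /andP[s1 s2].
  by rewrite !wx //; [exact: Heta|move: s2; rewrite ltr_norml; lra].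
have cw s : 0 < s -> s < b -> {within `[s, b], continuous w}.
  move=> s0 sb; apply/subspace_continuousP => t /=; rewrite /from_subspace in_itv /= => /andP[st].
  rewrite le_eqVlt => /predU1P[->|tb].
    apply/cvgrPdist_le => e e0; rewrite wb.
    rewrite near_withinE; exists (e / C); first by rewrite /= divr_gt0.
    move=> r; rewrite /ball_ /= in_itv /= => br /andP[sr].
    rewrite le_eqVlt => /predU1P[->|rb]; first by rewrite wb subrr normr0 ltW.
    rewrite wx //; apply: le_trans (zx _ _ rb) _; first by rewrite (le_trans (ltW s0)).
    move: br; rewrite gtr0_norm ?subr_gt0 // ltr_pdivlMr // => br; lra.
  apply: cvg_within_filter; apply: (@is_derive_continuous _ (f (w t))).
  by apply: dwx; rewrite (lt_le_trans s0 st).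
have dw t : 0 < t -> t < b + h -> is_derive t 1 w (f (w t)).
  move=> t0 tbh.
  have [tb|bt] := ltP t b; first by apply: dwx; rewrite t0.
  apply/is_derive_has_slope => eps eps0.
  have th : 0 <= t - b <= h by apply/andP; split; lra.
  have [e1 e10 H1] := dy _ th _ eps0.
  move: bt; rewrite le_eqVlt => /predU1P[bt|bt].
    rewrite -{}bt {t t0 tbh th} in H1 *.
    rewrite subrr y0 in H1.
    have := cf z => /cvgrPdist_le /(_ _ eps0) /nbhs_ballP[r /= r0 Hr].
    have rC : 0 < r / C by rewrite divr_gt0.
    (* On the right of [b], [e1] and [h] give access to the slope estimate for [y]. On the left, [b]
       keeps [s] positive and [r / C] keeps [x] within [r] of [z]. *)
    exists (Num.min (Num.min e1 h) (Num.min b (r / C))).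
      by rewrite !lt_min e10 h0 b0 rC.
    move=> s _; rewrite !lt_min => /andP[/andP[s1 s2] /andP[s3 s4]].
    have [sb|bs] := ltP s b; last first.
      rewrite wb wy //; have := H1 (s - b); rewrite subr0; apply => //.
      by move: s2; rewrite /= ltr_norml; lra.
    (* To the left of the junction, the mean value inequality on [[s, b]] is read backwards from
       [b]. *)
    apply: has_slope_opp; rewrite ltr0_norm ?subr_lt0 // opprB.
    have s0 : 0 < s by move: s3; rewrite ltr_norml; lra.
    apply: mean_value_ineq; [exact: ltW|exact: cw|].
    move=> t /andP[st tb]; exists (f (w t)); first by apply: dwx; rewrite (lt_trans s0).
    rewrite distrC wb wx //; apply: Hr; rewrite -ball_normE /ball_ /=.
    apply: le_lt_trans (zx t _ tb) _; first by rewrite (le_trans (ltW s0) (ltW st)).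
    move: s4; rewrite ltr0_norm ?subr_lt0 // opprB ltr_pdivlMr //.
    have : C * (b - t) <= C * (b - s) by rewrite ler_pM2l //; lra.
    lra.
  exists (Num.min e1 (Num.min (t - b) (b + h - t))).
    by rewrite !lt_min e10 !subr_gt0 bt.
  move=> s _; rewrite !lt_min => /andP[s1 /andP[s2 s3]].
  have bs : b <= s by move: s2; rewrite ltr_norml; lra.
  have sbh : s < b + h by move: s3; rewrite ltr_norml; lra.
  rewrite !wy ?(ltW bt) //; have := H1 (s - b).
  have -> : s - b - (t - b) = s - t by ring.
  apply => //=; apply/andP; split; lra.
exists (b + h), w; split; first by rewrite ltrDl.
  split; first by rewrite lte_fin addr_gt0.
    apply/subspace_continuousP => t [t0]; rewrite /from_subspace lte_fin => tbh.
    move: t0; rewrite le_eqVlt => /predU1P[<-|t0]; last first.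
      by apply: cvg_within_filter; apply: is_derive_continuous; exact: dw.
    have b2 : b / 2 < b by lra.
    have := cx 0 (b / 2) (lexx _) b2 => /subspace_continuousP /(_ 0).
    rewrite /from_subspace /= in_itv /= lexx divr_ge0 ?ltW // wx // => /(_ isT) H.
    apply/cvgrPdist_le => e e0; move/cvgrPdist_le : H => /(_ _ e0).
    rewrite !near_withinE => -[r /= r0 Hr].
    exists (Num.min r (b / 2)) => /=; first by rewrite lt_min r0 divr_gt0.
    move=> s /=; rewrite lt_min => /andP[s1 s2] [s0 _].
    move: (s2); rewrite sub0r normrN ger0_norm // => s2'.
    rewrite wx; last by lra.
    by apply: Hr; rewrite /= ?in_itv /= ?s0 ?ltW.
  by move=> t t0; rewrite lte_fin; exact: dw.
by move=> t /andP[_ tb]; rewrite wx.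
Unshelve. all: by end_near. Qed.

(** With a finite [b], the prolongation would contradict maximality. *)
Lemma bounded_maximal_solution_global f (b : \bar R) (M : R) x :
  (forall r : R, compact [set z : E | `|z| <= r]) -> continuous f ->
  maximal_solution_on f b x -> (forall t, time_domain b t -> `|x t| <= M) ->
  b = +oo%E.
Proof.
move=> cE cf [sx max] xM; have b0 : (0 < b)%E by case: sx.
case: b => [b| |] // in sx max xM b0 *.
have [t /andP[t0 tb]|b' [y [bb' sy yx]]] := solution_prolongation cE cf sx (M := M).
  by apply: xM; split; rewrite ?lte_fin.
have := max b'%:E y; rewrite lee_fin => /(_ (ltW bb') sy) H.
have : b'%:E = b%:E :> \bar R.
  by apply: H => t [t0 tb]; apply: yx; rewrite t0 -lte_fin.
by case=> E'; move: bb'; rewrite E' ltxx.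
Qed.
End Prolongation.

(** * Compactness and Euclidean geometry of column vectors *)

Section ColumnVectors.
Context {R : realType} {n : nat}.
Implicit Types (e u v : 'cV[R]_n).

Lemma cV_norm_coord e i : `|e i 0| <= `|e|.
Proof.
rewrite [leRHS]/Num.norm /= mx_normrE.
by have /bigmax_leP[_ /(_ (i, 0) isT)] := lexx (\big[Num.max/0]_ij `|e ij.1 ij.2|).
Qed.

Lemma cV_norm_le e (r : R) : 0 <= r -> (forall i, `|e i 0| <= r) -> `|e| <= r.
Proof.
move=> r0 er; rewrite [leLHS]/Num.norm /= mx_normrE.
by apply: bigmax_le => // -[i j] _; rewrite (ord1 j).
Qed.

(** The norm is the largest absolute value of a coordinate, so the ball is the transpose of a
    compact product of segments. *)
Lemma compact_cV_ball (r : R) : compact [set e : 'cV[R]_n | `|e| <= r].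
Proof.
have [r0|r0] := leP 0 r; last first.
  suff -> : [set e : 'cV[R]_n | `|e| <= r] = set0 by exact: compact0.
  by apply/seteqP; split=> // e /= er; have := normr_ge0 e; lra.
have trN (e : 'rV[R]_n) : `|e^T| <= `|e|.
  apply: cV_norm_le => // i; rewrite mxE [leRHS]/Num.norm /= mx_normrE.
  by have /bigmax_leP[_ /(_ (0, i) isT)] := lexx (\big[Num.max/0]_ij `|e ij.1 ij.2|).
have ctr : continuous (fun v : 'rV[R]_n => v^T).
  move=> e; apply/(@cvgrPdist_le _ _ _ (nbhs e) (nbhs_filter e)) => d d0; apply/nbhs_ballP; exists d => // e'.
  rewrite -ball_normE /ball_ /= => /ltW; apply: le_trans.
  by rewrite -linearB; exact: trN.
have -> : [set e : 'cV[R]_n | `|e| <= r] = (fun v : 'rV[R]_n => v^T) @` [set v : 'rV[R]_n | forall i, v ord0 i \in `[- r, r]].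
  apply/seteqP; split => [e /= er|_ [v vr <-] /=].
    exists e^T; last by rewrite trmxK.
    by move=> i; rewrite mxE in_itv /= -ler_norml (le_trans (cV_norm_coord _ _)).
  by apply: cV_norm_le => // i; rewrite mxE ler_norml; have := vr i; rewrite in_itv.
apply: continuous_compact; first exact: continuous_subspaceT.
by apply: (@rV_compact _ _ (fun=> `[- r, r]%classic)) => _; exact: segment_compact.
Qed.

Lemma compact_cV_pair_ball (r : R) :
  compact [set z : 'cV[R]_n * 'cV[R]_n | `|z| <= r].
Proof.
have -> : [set z : 'cV[R]_n * 'cV[R]_n | `|z| <= r] =
    [set e | `|e| <= r] `*` [set e | `|e| <= r].
  apply/seteqP; split=> [z|z] /=; rewrite prod_normE ge_max; first by move/andP.
  by move=> [-> ->].
by apply: compact_setX; exact: compact_cV_ball.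
Qed.

(** The Euclidean inner product. The norm of ['cV[R]_n] is the sup norm, so [sqnorm e] is in general
    not its square and the two have to be compared. *)
Definition dot u v : R := (u^T *m v) 0 0.

Lemma dotE u v : dot u v = \sum_i u i 0 * v i 0.
Proof. by rewrite /dot mxE; apply: eq_bigr => i _; rewrite mxE. Qed.

Lemma sqnormE e : sqnorm e = dot e e. Proof. by []. Qed.

Lemma dotC u v : dot u v = dot v u.
Proof. by rewrite !dotE; apply: eq_bigr => i _; rewrite mulrC. Qed.

Lemma dotDl u u' v : dot (u + u') v = dot u v + dot u' v.
Proof. by rewrite !dotE -big_split; apply: eq_bigr => i _; rewrite !mxE mulrDl. Qed.

Lemma dotZl (k : R) u v : dot (k *: u) v = k * dot u v.
Proof. by rewrite !dotE mulr_sumr; apply: eq_bigr => i _; rewrite !mxE mulrA. Qed.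

Lemma dot0l v : dot 0 v = 0.
Proof. by rewrite -(scale0r (0 : 'cV[R]_n)) dotZl mul0r. Qed.

Lemma dotDr u v v' : dot u (v + v') = dot u v + dot u v'.
Proof. by rewrite dotC dotDl !(dotC u). Qed.

Lemma dotZr (k : R) u v : dot u (k *: v) = k * dot u v.
Proof. by rewrite dotC dotZl dotC. Qed.

Lemma sqnorm_ge0 e : 0 <= sqnorm e.
Proof. by rewrite sqnormE dotE sumr_ge0 // => i _; rewrite -expr2 sqr_ge0. Qed.

Lemma sqr_coord_le_sqnorm e i : e i 0 ^+ 2 <= sqnorm e.
Proof.
rewrite sqnormE dotE (bigD1 i) //= expr2 lerDl sumr_ge0 // => j _.
by rewrite -expr2 sqr_ge0.
Qed.

Lemma sqnorm_eq0 e : (sqnorm e == 0) = (e == 0).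
Proof.
apply/eqP/eqP => [e0|->]; last by rewrite sqnormE dot0l.
apply/matrixP => i j; rewrite (ord1 j) !mxE; apply/eqP.
by rewrite -sqrf_eq0 eq_le sqr_ge0 andbT -e0 sqr_coord_le_sqnorm.
Qed.

Lemma sqnorm_gt0 e : (0 < sqnorm e) = (e != 0).
Proof. by rewrite lt0r sqnorm_eq0 sqnorm_ge0 andbT. Qed.

Lemma sqnorm0 : sqnorm (0 : 'cV[R]_n) = 0.
Proof. by apply/eqP; rewrite sqnorm_eq0. Qed.

Lemma coord_le_sqnorm e i : `|e i 0| <= sqnorm e `^ 2^-1.
Proof.
rewrite powR12_sqrt ?sqnorm_ge0 // -sqrtr_sqr ler_wsqrtr //.
exact: sqr_coord_le_sqnorm.
Qed.

(** With [a = sqnorm u], [b = dot u v] and [d = sqnorm v], the vector [b *: u - a *: v] has squared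
    length [a * (a * d - b ^+ 2)]. *)
Lemma cauchy_schwarz u v : dot u v ^+ 2 <= sqnorm u * sqnorm v.
Proof.
have [->|u0] := eqVneq u 0.
  by rewrite sqnorm0 mul0r dot0l expr0n.
have := sqnorm_ge0 (dot u v *: u + (- sqnorm u) *: v).
rewrite sqnormE !(dotDl, dotDr, dotZl, dotZr) -!sqnormE (dotC v u).
set a := sqnorm u; set b := dot u v; set d := sqnorm v.
move=> H; have : 0 <= a * (a * d - b ^+ 2) by lra.
by rewrite pmulr_rge0 ?sqnorm_gt0 // subr_ge0.
Qed.

Lemma cvg_dot (T : Type) (F : set_system T) (FF : Filter F) (f g : T -> 'cV[R]_n) u v :
  f @ F --> u -> g @ F --> v -> dot (f x) (g x) @[x --> F] --> dot u v.
Proof.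
move=> fu gv; rewrite dotE.
under eq_fun do rewrite dotE.
apply: cvg_big => [|i _]; first exact: add_continuous.
apply: cvgM.
  exact: (@continuous_cvg _ _ _ F FF _ (fun w : 'cV[R]_n => w i 0) _ (@coord_continuous _ _ _ i 0 u) fu).
exact: (@continuous_cvg _ _ _ F FF _ (fun w : 'cV[R]_n => w i 0) _ (@coord_continuous _ _ _ i 0 v) gv).
Qed.

Lemma is_derive_dot (f g : R -> 'cV[R]_n) (t : R) u v :
  is_derive t 1 f u -> is_derive t 1 g v ->
  is_derive t 1 (fun s => dot (f s) (g s)) (dot u (g t) + dot (f t) v).
Proof.
have coordD (h : R -> 'cV[R]_n) w i :
    is_derive t 1 h w -> is_derive t 1 (fun s => h s i 0) (w i 0).
  move=> /is_derive_has_slope hw; apply/is_derive_has_slope => eps /hw[d d0 Hd].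
  exists d => // s _ /(Hd s I); apply: le_trans.
  by have := cV_norm_coord (h s - h t - (s - t) *: w) i; rewrite !mxE.
move=> df dg.
have -> : (fun s => dot (f s) (g s)) = \sum_i ((fun s => f s i 0) * (fun s => g s i 0)).
  by apply/funext => s; rewrite dotE fct_sumE.
have dfi i := coordD f u i df; have dgi i := coordD g v i dg.
apply: is_derive_eq.
rewrite addrC !dotE -big_split; apply: eq_bigr => i _ /=.
by rewrite [u i 0 * _]mulrC.
Qed.

End ColumnVectors.

(** * The vector field: factorisation and continuity *)

Section ErrorSystem.
Context {R : realType} {n : nat}.
Implicit Types (e : 'cV[R]_n) (z : 'cV[R]_n * 'cV[R]_n) (k p : R).

Definition decay_exponent p : R := (p - 1) / (3 * p - 2).

(** The bound 1/4, the value at [p = 2], gives [2 * q < 1 / 2], which makes the most singular term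
    of [phi2] continuous. *)
Lemma decay_exponent_itv p : 1 < p < 2 -> 0 < decay_exponent p < 4^-1.
Proof.
move=> /andP[p1 p2]; have p0 : 0 < 3 * p - 2 by lra.
apply/andP; rewrite /decay_exponent; split; first by apply: divr_gt0 => //; rewrite subr_gt0.
by rewrite ltr_pdivrMr //; lra.
Qed.

(** For [1 < p < 2] the value at [e = 0] is 0, although the weight grows without bound as a nonzero
    [e] tends to 0. Lower bounds on it therefore assume [e != 0]. *)
Definition weight p e : R := sqnorm e `^ (- decay_exponent p).

Lemma phi1E k3 p e : phi1 k3 p e = (k3 + weight p e) *: e.
Proof. by rewrite /phi1 /weight scalerDl /decay_exponent -mulNr opprB. Qed.

(** This is [phi2 = J phi1]: the coefficients [(2 * p - 1) / (3 * p - 2)] and [p / (3 * p - 2)] are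
    [1 - q] and [1 - 2 * q]. *)
Lemma phi2E k3 p e : 1 < p < 2 ->
  phi2 k3 p e =
    ((k3 + (1 - 2 * decay_exponent p) * weight p e) * (k3 + weight p e)) *: e.
Proof.
move=> /andP[p1 p2]; have p0 : 3 * p - 2 != 0 by rewrite gt_eqF //; lra.
rewrite /phi2 -!scalerDl; congr (_ *: _).
have -> : 2 * (1 - p) / (3 * p - 2) = - decay_exponent p * 2%:R.
  by rewrite /decay_exponent; field.
have -> : (1 - p) / (3 * p - 2) = - decay_exponent p.
  by rewrite /decay_exponent; field.
rewrite powRrM powR_mulrn ?powR_ge0 // -/(weight p e) /decay_exponent.
by field.
Qed.

Lemma powR_continuous_at (r a : R) : 0 < a -> {for a, continuous (fun x => x `^ r)}.
Proof. by move=> a0; apply: is_derive_continuous; exact: is_derive1_powR. Qed.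

Lemma sqnorm_continuous : continuous (@sqnorm R n).
Proof.
by move=> e; exact: (@cvg_dot R n _ (nbhs e) (nbhs_filter e) id id e e cvg_id cvg_id).
Qed.

(** At 0 the norm of the value is at most [sqnorm e] to the power [1 / 2 - c], a positive exponent.
    Elsewhere the power itself is continuous. *)
Lemma sqnorm_powR_scale_continuous (c : R) : 0 < c < 2^-1 ->
  continuous (fun e => sqnorm e `^ (- c) *: e).
Proof.
move=> /andP[c0 c2] e; have [->|e0] := eqVneq e 0; last first.
  have cs : {for sqnorm e, continuous (fun a : R => a `^ (- c))}.
    by apply: powR_continuous_at; rewrite sqnorm_gt0.
  have := @continuous_cvg _ _ _ _ (nbhs_filter e) _ _ _ cs (@sqnorm_continuous e).
  by move=> /cvgZ; apply; exact: cvg_id.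
rewrite /continuous_at scaler0.
apply/(@cvgr0Pnorm_le _ _ _ (nbhs (0 : 'cV[R]_n)) (nbhs_filter _)) => eps eps0.
pose d := 2^-1 - c; have d0 : 0 < d by rewrite subr_gt0.
have ed : 0 < eps `^ d^-1 by rewrite powR_gt0.
have := @sqnorm_continuous 0; rewrite /continuous_at sqnorm0 => H.
have := cvgr_lt _ H _ ed => /(_ (nbhs_filter _)).
apply: filterS => {}e es.
have [->|e0] := eqVneq e 0; first by rewrite scaler0 normr0 ltW.
have s0 : 0 < sqnorm e by rewrite sqnorm_gt0.
apply: le_trans (_ : _ <= sqnorm e `^ d) _.
  rewrite normrZ ger0_norm ?powR_ge0 // /d addrC powRD; last by apply/implyP => _; rewrite gt_eqF.
  by rewrite ler_wpM2l ?powR_ge0 // cV_norm_le ?powR_ge0 //; exact: coord_le_sqnorm.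
apply: le_trans (_ : _ <= (eps `^ d^-1) `^ d) _.
  by apply: ge0_ler_powR; rewrite ?nnegrE ?ltW.
by rewrite -powRrM mulVf ?gt_eqF // powRr1 // ltW.
Qed.

Lemma phi1_continuous k3 p : 1 < p < 2 -> continuous (@phi1 R n k3 p).
Proof.
move=> hp e; have /andP[q0 q4] := decay_exponent_itv hp.
rewrite (_ : phi1 k3 p = fun e => k3 *: e + sqnorm e `^ (- decay_exponent p) *: e).
  apply: (cvgD (@scaler_continuous _ _ k3 e)).
  by apply: sqnorm_powR_scale_continuous; lra.
by apply/funext => e'; rewrite phi1E scalerDl.
Qed.

Lemma phi2_continuous k3 p : 1 < p < 2 -> continuous (@phi2 R n k3 p).
Proof.
move=> hp e; have /andP[q0 q4] := decay_exponent_itv hp.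
rewrite (_ : phi2 k3 p = fun e => k3 ^+ 2 *: e
    + (2 * k3 * (2 * p - 1) / (3 * p - 2)) *: (sqnorm e `^ (- decay_exponent p) *: e)
    + (p / (3 * p - 2)) *: (sqnorm e `^ (- (2 * decay_exponent p)) *: e)).
  have q1 : 0 < decay_exponent p < 2^-1 by lra.
  have q2 : 0 < 2 * decay_exponent p < 2^-1 by lra.
  have c1 := @sqnorm_powR_scale_continuous _ q1 e.
  have c2 := @sqnorm_powR_scale_continuous _ q2 e.
  exact: (cvgD (cvgD (@scaler_continuous _ _ (k3 ^+ 2) e) (cvgZl_tmp c1)) (cvgZl_tmp c2)).
apply/funext => e'; rewrite /phi2 !scalerA /decay_exponent.
by rewrite [2 * ((p - 1) / _)]mulrA -!mulNr [- 2 * _]mulNr -mulrN !opprB.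
Qed.

Lemma error_system_continuous k1 k2 k3 p : 1 < p < 2 ->
  continuous (@error_system R n k1 k2 k3 p).
Proof.
move=> hp z.
have cfst : y.1 @[y --> z] --> z.1 by exact: cvg_fst.
have csnd : y.2 @[y --> z] --> z.2 by exact: cvg_snd.
have c1 : phi1 k3 p y.1 @[y --> z] --> phi1 k3 p z.1.
  exact: (continuous_cvg _ (@phi1_continuous k3 p hp z.1) cfst).
have c2 : phi2 k3 p y.1 @[y --> z] --> phi2 k3 p z.1.
  exact: (continuous_cvg _ (@phi2_continuous k3 p hp z.1) cfst).
have c3 : - k1 *: phi1 k3 p y.1 + y.2 @[y --> z] --> - k1 *: phi1 k3 p z.1 + z.2.
  exact: (cvgD (cvgZl_tmp c1) csnd).
have c4 : - k2 *: phi2 k3 p y.1 @[y --> z] --> - k2 *: phi2 k3 p z.1.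
  exact: (cvgZl_tmp c2).
exact: (cvg_pair c3 c4).
Qed.

Lemma phi1_0 k3 p : phi1 k3 p 0 = 0 :> 'cV[R]_n.
Proof. by rewrite phi1E scaler0. Qed.

Lemma error_system0 k1 k2 k3 p : @error_system R n k1 k2 k3 p 0 = 0.
Proof. by rewrite /error_system phi1_0 /phi2 !scaler0 !addr0 scaler0. Qed.

End ErrorSystem.

(** * The quadratic Lyapunov function and its bounds *)

Section LyapunovFunction.
Context {R : realType} {n : nat}.
Variables (k1 k2 k3 p : R).
Hypotheses (hp : 1 < p < 2) (hk3 : 0 < k3) (hk1 : 0 < k1) (hk2 : 0 < k2).
Implicit Types (z : 'cV[R]_n * 'cV[R]_n).

Local Notation q := (decay_exponent p).

(** The diagonal of [P]. In the Lyapunov equation the (1,1) entry forces [k1 * lyap11 = k2 + 1], the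
    (1,2) entry forces [k2 * lyap22 = lyap11 + k1], and the (2,2) entry forces the off-diagonal
    value -1. *)
Definition lyap11 : R := (k2 + 1) / k1.
Definition lyap22 : R := (lyap11 + k1) / k2.

(* The quadratic form [[p11, -1], [-1, p22]] in (phi1 e1, e2); its matrix P
   solves the Lyapunov equation A^T P + P A = -2 I for the gain matrix A. *)
Definition lyapunov z : R :=
  lyap11 * sqnorm (phi1 k3 p z.1) - 2 * dot (phi1 k3 p z.1) z.2
  + lyap22 * sqnorm z.2.

Definition zeta_sqnorm z : R := sqnorm (phi1 k3 p z.1) + sqnorm z.2.

(** [det P / tr P] bounds the eigenvalues of [P] from below. In the upper bound, the 1 added to the
    trace absorbs the cross term. *)
Definition lyap_lower : R := (lyap11 * lyap22 - 1) / (lyap11 + lyap22).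
Definition lyap_upper : R := lyap11 + lyap22 + 1.

Lemma lyap11_gt0 : 0 < lyap11.
Proof. by rewrite divr_gt0 // addr_gt0. Qed.

Lemma lyap22_gt0 : 0 < lyap22.
Proof. by rewrite divr_gt0 // addr_gt0 // lyap11_gt0. Qed.

(** This says [det P > 0]. As [lyap11 * k1 = k2 + 1], the product is
    [(lyap11 ^+ 2 + k2 + 1) / k2]. *)
Lemma lyap_det_gt1 : 1 < lyap11 * lyap22.
Proof.
rewrite /lyap22 mulrA ltr_pdivlMr // mul1r mulrDr.
have -> : lyap11 * k1 = k2 + 1 by rewrite /lyap11 divfK // gt_eqF.
have : 0 < lyap11 * lyap11 by rewrite mulr_gt0 // lyap11_gt0.
lra.
Qed.

Lemma lyap_lower_gt0 : 0 < lyap_lower.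
Proof.
by rewrite divr_gt0 ?subr_gt0 ?lyap_det_gt1 // addr_gt0 ?lyap11_gt0 ?lyap22_gt0.
Qed.

Lemma lyap_upper_gt0 : 0 < lyap_upper.
Proof. by have := lyap11_gt0; have := lyap22_gt0; rewrite /lyap_upper; lra. Qed.

(** For [c = lyap_lower], the matrix [P - c I] has positive (1,1) entry and determinant [c ^+ 2], so
    it is positive semidefinite. The proof completes the square after multiplying by that entry. *)
Lemma lyap_lowerP z : lyap_lower * zeta_sqnorm z <= lyapunov z.
Proof.
have c0 := lyap_lower_gt0; have p1 := lyap11_gt0; have p2 := lyap22_gt0.
have cE : lyap_lower * (lyap11 + lyap22) = lyap11 * lyap22 - 1.
  by rewrite /lyap_lower divfK // gt_eqF // addr_gt0.
rewrite /lyapunov /zeta_sqnorm; move: (phi1 k3 p z.1) z.2 => f g.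
move: cE c0; set c := lyap_lower => cE c0.
have ac : 0 < lyap11 - c.
  rewrite subr_gt0 -(@ltr_pM2r _ (lyap11 + lyap22)) ?addr_gt0 // cE.
  by have := sqr_ge0 lyap11; rewrite expr2; lra.
have := sqnorm_ge0 ((lyap11 - c) *: f + (- 1) *: g).
rewrite sqnormE !(dotDl, dotDr, dotZl, dotZr) -!sqnormE (dotC g f) => H.
have D0 := sqnorm_ge0 g.
have cD : 0 <= c ^+ 2 * sqnorm g by rewrite mulr_ge0 // sqr_ge0.
rewrite -subr_ge0 -(pmulr_rge0 _ ac).
have ag : (lyap11 - c) * (lyap22 - c) = 1 + c ^+ 2.
  by rewrite mulrBr !mulrBl; move: cE; rewrite mulrDr; lra.
have agD : (lyap11 - c) * (lyap22 - c) * sqnorm g = sqnorm g + c ^+ 2 * sqnorm g.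
  by rewrite ag mulrDl mul1r.
by move: agD H cD; move: (sqnorm f) (sqnorm g) (dot f g) => A D B; lra.
Qed.

Lemma lyap_upperP z : lyapunov z <= lyap_upper * zeta_sqnorm z.
Proof.
have p1 := lyap11_gt0; have p2 := lyap22_gt0.
rewrite /lyapunov /zeta_sqnorm /lyap_upper; move: (phi1 k3 p z.1) z.2 => f g.
have := sqnorm_ge0 (f + g).
rewrite sqnormE !(dotDl, dotDr) -!sqnormE (dotC g f).
have : 0 <= lyap11 * sqnorm g by rewrite mulr_ge0 ?sqnorm_ge0 // ltW.
have : 0 <= lyap22 * sqnorm f by rewrite mulr_ge0 ?sqnorm_ge0 // ltW.
by lra.
Qed.

Lemma weight_ge0 (e : 'cV[R]_n) : 0 <= weight p e.
Proof. exact: powR_ge0. Qed.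

Lemma sqnorm_phi1 (e : 'cV[R]_n) :
  sqnorm (phi1 k3 p e) = (k3 + weight p e) ^+ 2 * sqnorm e.
Proof. by rewrite phi1E sqnormE dotZl dotZr mulrA expr2. Qed.

Lemma norm_sqr_le_sqnorm (e : 'cV[R]_n) : `|e| ^+ 2 <= sqnorm e.
Proof.
rewrite -[leRHS](sqr_sqrtr (sqnorm_ge0 e)) lerXn2r ?nnegrE //.
apply: cV_norm_le => // i.
by rewrite -powR12_sqrt ?sqnorm_ge0 //; exact: coord_le_sqnorm.
Qed.

(** Since [phi1] stretches [e1] by at least [k3], the quadratic bound in [zeta] becomes one in the
    state. Positivity, stability and boundedness all rest on it. *)
Lemma lyapunov_coercive : exists2 c : R, 0 < c & forall z, c * `|z| ^+ 2 <= lyapunov z.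
Proof.
exists (lyap_lower * Num.min 1 (k3 ^+ 2)).
  by rewrite mulr_gt0 ?lyap_lower_gt0 // lt_min ltr01 exprn_gt0.
move=> z; apply: le_trans (lyap_lowerP z).
rewrite -mulrA ler_pM2l ?lyap_lower_gt0 //.
set m := Num.min _ _.
have m0 : 0 <= m by rewrite le_min ler01 exprn_ge0 // ltW.
have m1 : m <= 1 by rewrite /m ge_min lexx.
have mk : m <= k3 ^+ 2 by rewrite /m ge_min lexx orbT.
have a0 := sqnorm_ge0 z.1; have d0 := sqnorm_ge0 z.2.
have H1 : m * sqnorm z.1 <= sqnorm (phi1 k3 p z.1).
  rewrite sqnorm_phi1; apply: ler_wpM2r => //; apply: le_trans mk _.
  have := weight_ge0 z.1; move: (weight p z.1) => w w0.
  have kw : 0 <= k3 * w by rewrite mulr_ge0 // ltW.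
  by have := sqr_ge0 w; lra.
have H2 : m * sqnorm z.2 <= sqnorm z.2 by rewrite -[leRHS]mul1r ler_wpM2r.
have h1 : m * `|z.1| ^+ 2 <= m * sqnorm z.1 by rewrite ler_wpM2l // norm_sqr_le_sqnorm.
have h2 : m * `|z.2| ^+ 2 <= m * sqnorm z.2 by rewrite ler_wpM2l // norm_sqr_le_sqnorm.
have h0 := sqnorm_ge0 (phi1 k3 p z.1).
rewrite /zeta_sqnorm prod_normE.
by case: (leP `|z.1| `|z.2|) => _; lra.
Qed.

Lemma lyapunov_continuous : continuous lyapunov.
Proof.
move=> z.
have cfst : y.1 @[y --> z] --> z.1 by exact: cvg_fst.
have csnd : y.2 @[y --> z] --> z.2 by exact: cvg_snd.
have c1 : phi1 k3 p y.1 @[y --> z] --> phi1 k3 p z.1.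
  exact: (continuous_cvg _ (@phi1_continuous _ _ k3 p hp z.1) cfst).
apply: cvgD; last by apply: cvgM; [exact: cvg_cst|exact: cvg_dot].
by apply: cvgB; apply: cvgM; [exact: cvg_cst|exact: cvg_dot|exact: cvg_cst|exact: cvg_dot].
Qed.

Lemma lyapunov0 : lyapunov 0 = 0.
Proof.
by rewrite /lyapunov /= phi1_0 sqnorm0 dot0l !(mul0r, mulr0) subr0 addr0.
Qed.

Lemma lyapunov_gt0 z : z != 0 -> 0 < lyapunov z.
Proof.
move=> z0; have [c c0 /(_ z)] := lyapunov_coercive.
by apply: lt_le_trans; rewrite mulr_gt0 // exprn_gt0 // normr_gt0.
Qed.

Lemma lyapunov_ge0 z : 0 <= lyapunov z.
Proof. by have [->|/lyapunov_gt0/ltW] := eqVneq z 0; first rewrite lyapunov0. Qed.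

End LyapunovFunction.

(** * The differential inequality for the Lyapunov function *)

Section Dissipation.
Context {R : realType} {n : nat}.
Variables (k1 k2 k3 p : R).
Hypotheses (hp : 1 < p < 2) (hk3 : 0 < k3) (hk1 : 0 < k1) (hk2 : 0 < k2).
Implicit Types (z : 'cV[R]_n * 'cV[R]_n).

Local Notation q := (decay_exponent p).
Local Notation V := (@lyapunov R n k1 k2 k3 p).
Local Notation N := (@zeta_sqnorm R n k3 p).

Lemma is_derive_fst (x : R -> 'cV[R]_n * 'cV[R]_n) (t : R) l :
  is_derive t 1 x l -> is_derive t 1 (fun s => (x s).1) l.1.
Proof.
move=> /is_derive_has_slope hx; apply/is_derive_has_slope => eps /hx[d d0 Hd].
exists d => // s _ /(Hd s I); apply: le_trans.
by rewrite [leRHS]prod_normE le_max lexx.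
Qed.

Lemma is_derive_snd (x : R -> 'cV[R]_n * 'cV[R]_n) (t : R) l :
  is_derive t 1 x l -> is_derive t 1 (fun s => (x s).2) l.2.
Proof.
move=> /is_derive_has_slope hx; apply/is_derive_has_slope => eps /hx[d d0 Hd].
exists d => // s _ /(Hd s I); apply: le_trans.
by rewrite [leRHS]prod_normE le_max lexx orbT.
Qed.

(* [j = k3 + (1 - 2 q) w] is the eigenvalue of the Jacobian of [phi1] in the
   direction [e1]. The derivative equals
   [-2 (j |phi1|^2 + (k3 + w) |e2|^2 - 2 q w (e1 . e2)^2 / |e1|^2)], and
   [j = k3 + w - 2 q w], so Cauchy-Schwarz applies. *)
Lemma lyapunov_derivative (x : R -> 'cV[R]_n * 'cV[R]_n) (t : R) :
  is_derive t 1 x (error_system k1 k2 k3 p (x t)) -> (x t).1 != 0 ->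
  exists2 D, is_derive t 1 (fun s => V (x s)) D &
    D <= - (2 * (k3 + (1 - 2 * q) * weight p (x t).1) * N (x t)).
Proof.
move=> dx e10; have /andP[q0 q4] := decay_exponent_itv hp.
have dx1 := is_derive_fst dx; have dx2 := is_derive_snd dx.
have da := is_derive_dot dx1 dx1.
have db := is_derive_dot dx1 dx2.
have dd := is_derive_dot dx2 dx2.
rewrite /= phi1E (phi2E _ _ hp) !(dotDl, dotDr, dotZl, dotZr) in da db dd.
pose a s := dot (x s).1 (x s).1.
pose b s := dot (x s).1 (x s).2.
pose d s := dot (x s).2 (x s).2.
have a0 : 0 < a t by rewrite /a -sqnormE sqnorm_gt0.
pose w s := a s `^ (- q).
(* Written in the scalars [a], [b], [d] and [w], [V] can be differentiated by the real product and
   chain rules. *)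
have VE : (fun s => V (x s)) =
  cst (lyap11 k1 k2) * ((cst k3 + w) * (cst k3 + w) * a)
   - cst 2 * ((cst k3 + w) * b) + cst (lyap22 k1 k2) * d.
  apply/funext => s; rewrite /lyapunov sqnorm_phi1 expr2 phi1E dotZl.
  by rewrite /weight sqnormE.
have wE : weight p (x t).1 = w t by [].
have wa : a t `^ (- q - 1) = w t / a t.
  by rewrite powRB ?powRr1 ?(ltW a0) //; apply/implyP => _; rewrite gt_eqF.
have cs : b t ^+ 2 / a t <= d t.
  by rewrite ler_pdivrMr // mulrC; exact: cauchy_schwarz.
have N_E : N (x t) = (k3 + w t) ^+ 2 * a t + d t by rewrite /zeta_sqnorm sqnorm_phi1.
rewrite wE N_E.
set j := k3 + (1 - 2 * q) * w t.
have Da : is_derive t 1 a (2 * (b t - k1 * (k3 + w t) * a t)).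
  by apply: (is_derive_eq da); rewrite (dotC (x t).2 (x t).1) wE /a /b; ring.
have Db : is_derive t 1 b (d t - k1 * (k3 + w t) * b t - k2 * (j * (k3 + w t)) * a t).
  by apply: (is_derive_eq db); rewrite wE /j /a /b /d; ring.
have Dd : is_derive t 1 d (- 2 * k2 * (j * (k3 + w t)) * b t).
  by apply: (is_derive_eq dd); rewrite (dotC (x t).2 (x t).1) wE /j /b; ring.
have Dw : is_derive t 1 w (- q * (w t / a t) * (2 * (b t - k1 * (k3 + w t) * a t))).
  by rewrite -wa; exact: (is_derive1_comp (is_derive1_powR (- q) a0) Da).
rewrite VE; eexists.
  exact: is_deriveD.
rewrite !(scaler0, add0r, addr0) /GRing.scale /= /cst.
rewrite !fctE.
have jE : j = k3 + w t - 2 * q * w t by rewrite /j; ring.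
have w0 : 0 <= w t by exact: powR_ge0.
have csw : q * w t * (b t ^+ 2 / a t) <= q * w t * d t.
  by rewrite ler_wpM2l // mulr_ge0 // ltW.
have a0' : a t != 0 by rewrite gt_eqF.
have k10 : k1 != 0 by rewrite gt_eqF.
have k20 : k2 != 0 by rewrite gt_eqF.
(* The values of [lyap11] and [lyap22] cancel all terms linear in [b t]. *)
rewrite [leLHS](_ : _ = - (2 * j * ((k3 + w t) ^+ 2 * a t)) - 2 * (k3 + w t) * d t
    + 4 * (q * w t * (b t ^+ 2 / a t))); last first.
  by rewrite jE /lyap22 /lyap11; field; rewrite ?k10 ?k20 ?a0'.
by rewrite jE; lra.
Qed.

(** This is [1 - alpha]. It converts the power [1 - 2 * q] of [sqnorm e1], which [N] dominates, into
    the power [q] that defines the weight. *)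
Definition lyap_exponent : R := q / (1 - 2 * q).
(** The rates come from [2 * (k3 + (1 - 2 * q) * w) * N] by inserting [N >= V / lyap_upper] and the
    lower bound of [w] in terms of [V]. *)
Definition lyap_rate1 : R := 2 * k3 / lyap_upper k1 k2.
Definition lyap_rate2 : R :=
  2 * (1 - 2 * q) * lyap_lower k1 k2 `^ lyap_exponent / lyap_upper k1 k2.

Lemma lyap_exponent_itv : 0 < lyap_exponent < 1.
Proof.
have /andP[q0 q4] := decay_exponent_itv hp; have q2 : 0 < 1 - 2 * q by lra.
by apply/andP; rewrite /lyap_exponent; split; [rewrite divr_gt0|rewrite ltr_pdivrMr //; lra].
Qed.

Lemma lyap_rate1_gt0 : 0 < lyap_rate1.
Proof. by rewrite divr_gt0 ?mulr_gt0 // lyap_upper_gt0. Qed.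

Lemma lyap_rate2_gt0 : 0 < lyap_rate2.
Proof.
have /andP[q0 q4] := decay_exponent_itv hp; have q2 : 0 < 1 - 2 * q by lra.
by rewrite divr_gt0 ?lyap_upper_gt0 // !mulr_gt0 // powR_gt0 // lyap_lower_gt0.
Qed.

(* [N >= w^2 |e1|^2 = (|e1|^2)^(1 - 2 q)], hence [w >= N^(- beta)]. *)
Lemma weight_ge z : z.1 != 0 ->
  lyap_lower k1 k2 `^ lyap_exponent / V z `^ lyap_exponent <= weight p z.1.
Proof.
move=> z0; have /andP[q0 q4] := decay_exponent_itv hp.
have q2 : 0 < 1 - 2 * q by lra.
have /andP[b0 b1] := lyap_exponent_itv.
have a0 : 0 < sqnorm z.1 by rewrite sqnorm_gt0.
have w0 : 0 < weight p z.1 by exact: powR_gt0.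
have c0 := lyap_lower_gt0 hk1 hk2.
have NV : lyap_lower k1 k2 * N z <= V z by exact: lyap_lowerP.
have aN : sqnorm z.1 `^ (1 - 2 * q) <= N z.
  apply: le_trans (_ : _ <= sqnorm (phi1 k3 p z.1)) _; last first.
    by rewrite /zeta_sqnorm lerDl sqnorm_ge0.
  rewrite sqnorm_phi1 powRD; last by apply/implyP => _; rewrite gt_eqF.
  rewrite powRr1 ?sqnorm_ge0 // mulrC ler_pM2r //.
  have -> : - (2 * q) = - q * 2%:R by ring.
  rewrite powRrM powR_mulrn ?powR_ge0 // -/(weight p z.1).
  by have : 0 <= k3 * weight p z.1; [rewrite mulr_ge0 // ltW|have := sqr_ge0 k3; lra].
have aV : lyap_lower k1 k2 `^ lyap_exponent * sqnorm z.1 `^ q <= V z `^ lyap_exponent.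
  have -> : sqnorm z.1 `^ q = (sqnorm z.1 `^ (1 - 2 * q)) `^ lyap_exponent.
    by rewrite -powRrM /lyap_exponent mulrC divfK // gt_eqF.
  rewrite -powRM ?powR_ge0 ?(ltW c0) //.
  apply: ge0_ler_powR; rewrite ?nnegrE ?(ltW b0) //.
  - by rewrite mulr_ge0 ?powR_ge0 // ltW.
  - exact: lyapunov_ge0.
  - by apply: le_trans NV; rewrite ler_pM2l.
have V0 : 0 < V z.
  by apply: lyapunov_gt0 => //; apply: contra_neq z0 => ->.
by rewrite /weight powRN ler_pdivrMr ?powR_gt0 // mulrC ler_pdivlMr ?powR_gt0.
Qed.

(** The quotient of [V] by its power [lyap_exponent] plays the role of [V] to the power [alpha]. *)
Lemma lyapunov_dissipation (x : R -> 'cV[R]_n * 'cV[R]_n) (t : R) :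
  is_derive t 1 x (error_system k1 k2 k3 p (x t)) -> (x t).1 != 0 ->
  exists2 D, is_derive t 1 (fun s => V (x s)) D &
    D <= - lyap_rate1 * V (x t) - lyap_rate2 * (V (x t) / V (x t) `^ lyap_exponent).
Proof.
move=> dx x0; have [D dV HD] := lyapunov_derivative dx x0.
exists D => //; apply: le_trans HD _.
have /andP[q0 q4] := decay_exponent_itv hp; have q2 : 0 < 1 - 2 * q by lra.
have C0 := lyap_upper_gt0 hk1 hk2.
have V0 : 0 <= V (x t) by exact: lyapunov_ge0.
have VN : V (x t) / lyap_upper k1 k2 <= N (x t).
  by rewrite ler_pdivrMr // mulrC; exact: lyap_upperP.
have := weight_ge x0; set u := _ / _ => uw.
have u0 : 0 <= u by rewrite divr_ge0 // powR_ge0.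
have w0 := weight_ge0 p (x t).1.
have H1 : k3 * (V (x t) / lyap_upper k1 k2) <= k3 * N (x t) by rewrite ler_pM2l.
have H2 : u * (V (x t) / lyap_upper k1 k2) <= weight p (x t).1 * N (x t).
  by apply: ler_pM => //; rewrite divr_ge0 // ltW.
have H3 : (1 - 2 * q) * (u * (V (x t) / lyap_upper k1 k2)) <=
    (1 - 2 * q) * (weight p (x t).1 * N (x t)) by rewrite ler_pM2l.
rewrite [leRHS](_ : _ = - (2 * (k3 * (V (x t) / lyap_upper k1 k2)))
  - 2 * ((1 - 2 * q) * (u * (V (x t) / lyap_upper k1 k2)))); first by lra.
by rewrite /lyap_rate1 /lyap_rate2 /u; ring.
Qed.
End Dissipation.

(** The derivative is only requested just after [t], not at [t], which accommodates isolated
    instants where [W] is not differentiable. *)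
Lemma le_of_right_derive_le0 (R : realType) (W : R -> R) (a b : R) :
  a <= b -> {within `[a, b], continuous W} ->
  (forall t, a < t < b -> W a < W t ->
    \forall s \near t^'+, exists2 D, is_derive (s : R) 1 W D & D <= 0) ->
  W b <= W a.
Proof.
move=> ab cW dW; apply: le_of_right_locally_le => // t /andP[at_ tb] Wt.
have := dW t; rewrite at_ tb => /(_ isT Wt).
rewrite /at_right !near_withinE => -[d /= d0 Hd].
exists (Num.min d (b - t)) => /=; first by rewrite lt_min d0 subr_gt0.
move=> s /=; rewrite lt_min => /andP[ds bs] ts.
have sb : s < b by move: bs; rewrite ltr_norml; lra.
have dr r : r \in `]t, s[%R -> exists2 D, is_derive r 1 W D & D <= 0.
  rewrite in_itv /= => /andP[tr rs]; apply: Hd => //=.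
  by move: ds; rewrite !ltr0_norm ?subr_lt0 //; lra.
apply: (@ler0_derive1_le_cc R W t s); rewrite ?in_itv /= ?lexx ?(ltW ts) //.
- by move=> r /dr[D []].
- by move=> r /dr[D [_ rD] D0]; rewrite derive1E rD.
apply: continuous_subspaceW cW => r /=; rewrite !in_itv /= => /andP[tr rs].
by rewrite (le_trans (ltW at_) tr) (le_trans rs (ltW sb)).
Qed.

(** * Decay of the Lyapunov function along solutions *)

Section Decay.
Context {R : realType} {n : nat}.
Variables (k1 k2 k3 p : R).
Hypotheses (hp : 1 < p < 2) (hk3 : 0 < k3) (hk1 : 0 < k1) (hk2 : 0 < k2).

Local Notation F := (@error_system R n k1 k2 k3 p).
Local Notation V := (@lyapunov R n k1 k2 k3 p).
Local Notation beta := (lyap_exponent p).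
Local Notation lam1 := (lyap_rate1 k1 k2 k3).
Local Notation lam2 := (lyap_rate2 k1 k2 p).

Variables (b : \bar R) (x : R -> 'cV[R]_n * 'cV[R]_n).
Hypothesis (sx : solution_on F b x).

(* If e1 vanishes while e2 does not, then e1' = e2 there, so e1 is nonzero
   immediately afterwards. *)
Lemma solution_fst_neq0 (t : R) : 0 < t -> (t%:E < b)%E -> x t != 0 ->
  \forall s \near t^'+, (x s).1 != 0.
Proof.
case: sx => _ _ dx t0 tb xt.
have := is_derive_fst (dx t t0 tb); rewrite /= => d1.
have [e10|e10] := eqVneq (x t).1 0; last first.
  have := is_derive_continuous d1 => c1.
  rewrite /at_right near_withinE.
  have := @continuous_cvg _ _ _ _ (nbhs_filter t) _ _ _ (@sqnorm_continuous R n (x t).1) c1.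
  move=> c2; have s0 : 0 < sqnorm (x t).1 by rewrite sqnorm_gt0.
  have := cvgr_gt _ c2 _ s0 => /(_ (nbhs_filter _)).
  by apply: filterS => s; rewrite /= sqnorm_gt0.
have e20 : (x t).2 != 0.
  by apply: contra_neq xt => e20; case: (x t) e10 e20 => e1 e2 /= -> ->.
rewrite e10 phi1_0 scaler0 add0r in d1.
have n0 : 0 < `|(x t).2| / 2 by rewrite divr_gt0 // normr_gt0.
have [d d0 Hd] := (is_derive_has_slope _ _ _).1 d1 _ n0.
rewrite /at_right near_withinE /nbhs /=; exists d => // s; rewrite /ball_ /= distrC => sd ts.
 have := Hd s I sd; rewrite e10 subr0.
apply: contraTneq => ->; rewrite sub0r normrN normrZ -ltNge mulrC ltr_pM2l.
  by rewrite ltr_pdivrMr // ltr_pMr ?normr_gt0 // ltr1n.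
by rewrite normr_gt0 subr_eq0 gt_eqF.
Qed.

Lemma solution_within_continuous (s t : R) : 0 <= s -> (t%:E < b)%E ->
  {within `[s, t], continuous x}.
Proof.
case: sx => _ cx _ s0 tb; apply: continuous_subspaceW cx => r /=.
rewrite in_itv/= /time_domain /= => /andP[sr rt]; split; first exact: le_trans sr.
by apply: le_lt_trans tb; rewrite lee_fin.
Qed.

Lemma lyapunov_within_continuous (s t : R) : 0 <= s -> (t%:E < b)%E ->
  {within `[s, t], continuous (fun r => V (x r))}.
Proof.
move=> s0 tb; have := solution_within_continuous s0 tb => /subspace_continuousP cx.
apply/subspace_continuousP => r rs.
exact: (continuous_cvg _ (@lyapunov_continuous R n k1 k2 k3 p hp (x r)) (cx r rs)).
Qed.

Lemma dissipation_near (t : R) : 0 < t -> (t%:E < b)%E -> x t != 0 ->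
  \forall s \near t^'+, 0 < V (x s) /\ exists2 D, is_derive (s : R) 1 (fun r => V (x r)) D &
    D <= - lam1 * V (x s) - lam2 * (V (x s) / V (x s) `^ beta).
Proof.
move=> t0 tb xt.
have tb' : \forall s \near t^'+, (s%:E < b)%E.
  case: b tb => [b'| |] //=.
  - by rewrite lte_fin => tb; near=> s; rewrite lte_fin; near: s; exact: nbhs_right_lt.
  - by move=> _; near=> s; rewrite ltry.
near=> s.
have ts : t < s by near: s; exact: nbhs_right_gt.
have sb : (s%:E < b)%E by near: s.
have xs : (x s).1 != 0 by near: s; exact: solution_fst_neq0.
have s0 : 0 < s by exact: lt_trans ts.
split; first by apply: lyapunov_gt0 => //; apply: contra_neq xs => ->.
by case: sx => _ _ dx; apply: lyapunov_dissipation => //; exact: dx.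
Unshelve. all: by end_near. Qed.

Lemma lyapunov_nonincreasing (s t : R) : 0 <= s -> s <= t -> (t%:E < b)%E ->
  V (x t) <= V (x s).
Proof.
move=> s0 st tb; apply: (@le_of_right_derive_le0 _ (fun r => V (x r))) => //.
  exact: lyapunov_within_continuous.
move=> r /andP[sr rt] Vr; have r0 : 0 < r by exact: le_lt_trans sr.
have rb : (r%:E < b)%E by apply: lt_trans tb; rewrite lte_fin.
(* The comparison principle only tests instants where [V] exceeds its initial value, which is
   nonnegative; this excludes the origin. *)
have xr : x r != 0.
  apply: contraTneq Vr => ->; rewrite lyapunov0 -leNgt; exact: lyapunov_ge0.
have := dissipation_near r0 rb xr; apply: filterS => r' [V0 [D dD HD]].
exists D => //; apply: le_trans HD _.
have l1 : 0 <= lam1 * V (x r') by apply: mulr_ge0; apply/ltW => //; exact: lyap_rate1_gt0.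
have l2 : 0 <= lam2 * (V (x r') / V (x r') `^ beta).
  apply: mulr_ge0; first exact/ltW/lyap_rate2_gt0.
  by rewrite divr_ge0 ?powR_ge0 // ltW.
by lra.
Qed.

Lemma solution_stays_at_0 (s t : R) : 0 <= s -> s <= t -> (t%:E < b)%E ->
  x s = 0 -> x t = 0.
Proof.
move=> s0 st tb xs; have := lyapunov_nonincreasing s0 st tb.
rewrite xs lyapunov0; apply: contraTeq => xt.
by rewrite -ltNge; exact: lyapunov_gt0.
Qed.

(** The power [u] of [V] with exponent [beta] satisfies [u' <= - beta * (lam1 * u + lam2)].
    Multiplying [lam1 * u + lam2] by the integrating factor gives a nonincreasing function. *)
Lemma lyapunov_powR_decay (T : R) : 0 <= T -> (T%:E < b)%E -> x T != 0 ->
  (lam1 * V (x T) `^ beta + lam2) * expR (beta * lam1 * T) <=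
  lam1 * V (x 0) `^ beta + lam2.
Proof.
move=> T0 Tb xT.
have /andP[b0 b1] := lyap_exponent_itv hp.
have l1 := lyap_rate1_gt0 hk3 hk1 hk2; have l2 := lyap_rate2_gt0 hp hk1 hk2.
(* Having left the origin at [T], the solution cannot have met it before. Hence [V > 0] on [[0, T]],
   where its power is continuous. *)
have x0 (s : R) : 0 <= s -> s <= T -> x s != 0.
  by move=> s0 sT; apply: contra_neq xT; exact: solution_stays_at_0.
pose W s := (lam1 * V (x s) `^ beta + lam2) * expR (beta * lam1 * s).
suff : W T <= W 0 by rewrite /W mulr0 expR0 mulr1.
apply: le_of_right_derive_le0 => //.
  apply/subspace_continuousP => r rT.
  have FF : Filter (within `[0, T] (nbhs r)) by exact: within_filter.
  have := lyapunov_within_continuous (lexx 0) Tb => /subspace_continuousP /(_ r rT) cV.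
  have Vr : 0 < V (x r).
    by move: rT; rewrite /= in_itv /= => /andP[r0 rT]; apply: lyapunov_gt0 => //; exact: x0.
  have cVb : V (x s) `^ beta @[s --> within `[0, T] (nbhs r)] --> V (x r) `^ beta.
    exact: (continuous_cvg _ (@powR_continuous_at _ beta _ Vr) cV).
  have ce : expR (beta * lam1 * s) @[s --> within `[0, T] (nbhs r)] --> expR (beta * lam1 * r).
    have cid : s @[s --> within `[0, T] (nbhs r)] --> r by exact: cvg_within.
    exact: (continuous_cvg _ (@continuous_expR R _) (cvgM (cvg_cst (beta * lam1)) cid)).
  have c1 : lam1 * V (x s) `^ beta @[s --> within `[0, T] (nbhs r)] --> lam1 * V (x r) `^ beta.
    exact: (cvgM (cvg_cst lam1) cVb).
  have c2 : lam1 * V (x s) `^ beta + lam2 @[s --> within `[0, T] (nbhs r)] -->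
      lam1 * V (x r) `^ beta + lam2.
    exact: (cvgD c1 (cvg_cst lam2)).
  exact: (cvgM c2 ce).
move=> r /andP[r0 rT] _.
have rb : (r%:E < b)%E by apply: lt_trans Tb; rewrite lte_fin.
have := dissipation_near r0 rb (x0 _ (ltW r0) (ltW rT)).
apply: filterS => s [V0 [D dD HD]].
have dVb := @is_derive1_comp _ (fun y => y `^ beta) (fun r => V (x r)) s _ _
  (is_derive1_powR beta V0) dD.
have de : is_derive s 1 (fun s => expR (beta * lam1 * s))
    (expR (beta * lam1 * s) * (beta * lam1)).
  apply: (@is_derive1_comp _ expR (fun s => beta * lam1 * s)).
  have -> : (fun s => beta * lam1 * s) = (beta * lam1) \*: (@id R) by [].
  by apply: is_derive_eq; rewrite /GRing.scale /= mulr1.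
have WE : W = (lam1 \*: ((fun y => y `^ beta) \o (fun r => V (x r))) + cst lam2) *
    (fun s => expR (beta * lam1 * s)) by [].
rewrite WE; eexists; first exact: is_deriveM.
rewrite /= /GRing.scale /= addr0 /cst.
have Vb1 : V (x s) `^ (beta - 1) = V (x s) `^ beta / V (x s).
  by rewrite powRB ?powRr1 ?(ltW V0) //; apply/implyP => _; rewrite gt_eqF.
rewrite Vb1.
have Vb0 : 0 < V (x s) `^ beta by exact: powR_gt0.
have e0 : 0 < expR (beta * lam1 * s) by exact: expR_gt0.
rewrite [leLHS](_ : _ = expR (beta * lam1 * s) * (beta * lam1) *
    (lam1 * V (x s) `^ beta + lam2 + V (x s) `^ beta / V (x s) * D)); last first.
  by rewrite !fctE /= /GRing.scale /=; ring.
apply: mulr_ge0_le0; first by rewrite ltW //; do 2?apply: mulr_gt0 => //.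
have uv0 : 0 < V (x s) `^ beta / V (x s) by rewrite divr_gt0.
have : V (x s) `^ beta / V (x s) * D <= V (x s) `^ beta / V (x s) *
    (- lam1 * V (x s) - lam2 * (V (x s) / V (x s) `^ beta)) by rewrite ler_pM2l.
rewrite [leRHS](_ : _ = - lam1 * V (x s) `^ beta - lam2); first by lra.
by field; rewrite (gt_eqF V0) (gt_eqF Vb0).
Qed.

Lemma solution_bounded : exists M : R, forall t, time_domain b t -> `|x t| <= M.
Proof.
have [c c0 Hc] := lyapunov_coercive (n := n) p hk3 hk1 hk2.
exists (V (x 0) / c + 1) => t [t0 tb].
have := le_trans (Hc (x t)) (lyapunov_nonincreasing (lexx 0) t0 tb).
rewrite mulrC -ler_pdivlMr // => H.
(* The elementary bound [r <= r ^+ 2 + 1] replaces a square root. *)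
by have := sqr_ge0 (`|x t| - 1); have := normr_ge0 (x t); lra.
Qed.

End Decay.

(** * Lyapunov stability and the settling time *)

Theorem theorem1 (R : realType) (n : nat) (hn : (1 <= n)%N) (p k3 k1 k2 : R)
    (hp : 1 < p < 2) (hk3 : 0 < k3) (hk1 : 0 < k1) (hk2 : 0 < k2)
    (hA : hurwitz (gain_matrix k1 k2)) :
  fast_finite_time_stable (@error_system R n k1 k2 k3 p).
Proof.
have l1 := lyap_rate1_gt0 hk3 hk1 hk2; have l2 := lyap_rate2_gt0 hp hk1 hk2.
have /andP[b0 b1] := lyap_exponent_itv hp.
split; first exact: error_system0.
  move=> eps eps0.
  have [c c0 Hc] := lyapunov_coercive (n := n) p hk3 hk1 hk2.
  have ce : 0 < c * eps ^+ 2 by rewrite mulr_gt0 // exprn_gt0.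
  have cV := @lyapunov_continuous R n k1 k2 k3 p hp 0.
  (* Sublevel sets of [V] stay inside the ball of radius [eps] by coercivity, and contain a ball
     around 0 by continuity. *)
  have : \forall z \near (0 : 'cV[R]_n * 'cV[R]_n), lyapunov k1 k2 k3 p z < c * eps ^+ 2.
    by apply: (cvgr_lt _ cV); rewrite lyapunov0.
  move=> /nbhs_ballP[d /= d0 Hd]; exists d => // b x sx x0 t [t0 tb].
  have V0 : lyapunov k1 k2 k3 p (x 0) < c * eps ^+ 2.
    by apply: Hd; rewrite -ball_normE /ball_ /= sub0r normrN.
  have := lyapunov_nonincreasing hp hk3 hk1 hk2 sx (lexx 0) t0 tb.
  move=> /(le_trans (Hc (x t)))/le_lt_trans/(_ V0).
  by rewrite ltr_pM2l // ltr_pXn2r ?nnegrE // ltW.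
exists (lyapunov k1 k2 k3 p), (lyap_rate1 k1 k2 k3), (lyap_rate2 k1 k2 p),
  (1 - lyap_exponent p); split => //.
- split; first exact: lyapunov_continuous.
  by split; [exact: lyapunov0|move=> z; exact: lyapunov_gt0].
- by apply/andP; split; lra.
move=> b x mx; have [sx _] := mx.
have [M xM] := solution_bounded hp hk3 hk1 hk2 sx.
have bE := bounded_maximal_solution_global (@compact_cV_pair_ball R n)
  (error_system_continuous hp) mx xM.
have ltb t : (t%:E < b)%E by rewrite bE ltry.
have -> : 1 - (1 - lyap_exponent p) = lyap_exponent p by ring.
set u := lyapunov k1 k2 k3 p (x 0) `^ lyap_exponent p.
(* The required upper bound itself is taken as settling time. It is an admissible instant because
   [b] is infinite. *)
set T := (_ * _)^-1 * ln _.
have u0 : 0 <= lyap_rate1 k1 k2 k3 * u by rewrite mulr_ge0 ?powR_ge0 // ltW.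
have r1 : 1 <= (lyap_rate1 k1 k2 k3 * u + lyap_rate2 k1 k2 p) / lyap_rate2 k1 k2 p.
  by rewrite ler_pdivlMr // mul1r lerDr.
have T0 : 0 <= T by rewrite mulr_ge0 ?ln_ge0 // invr_ge0 mulr_ge0 // ltW.
(* At this [T] the exponential factor equals the quotient inside the logarithm. A nonzero [x T]
   would then make [lam1] times a positive power of [V (x T)] nonpositive. *)
have xT : x T = 0.
  apply/eqP; apply: contraT => xT.
  have := lyapunov_powR_decay hp hk3 hk1 hk2 sx T0 (ltb T) xT.
  have -> : lyap_exponent p * lyap_rate1 k1 k2 k3 * T =
      ln ((lyap_rate1 k1 k2 k3 * u + lyap_rate2 k1 k2 p) / lyap_rate2 k1 k2 p).
    rewrite /T (mulrC (lyap_exponent p)) mulrA mulfV ?mul1r //.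
    by rewrite gt_eqF // mulr_gt0.
  rewrite -/u lnK; last by rewrite posrE (lt_le_trans ltr01).
  rewrite mulrA ler_pdivrMr // mulrC ler_pM2l; last by rewrite ltr_wpDl.
  have : 0 < lyap_rate1 k1 k2 k3 * lyapunov k1 k2 k3 p (x T) `^ lyap_exponent p.
    by rewrite mulr_gt0 // powR_gt0 // lyapunov_gt0.
  lra.
exists T; split => //.
by move=> t _ Tt; exact: (solution_stays_at_0 hp hk3 hk1 hk2 sx T0 Tt (ltb t) xT).
Qed.
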